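(* Let $V$ be a Euclidean vector space with orthonormal basis $\{e_\mu\}$. Consider $c=\sum_\alpha c_\alpha\Gamma_{I_\alpha}$ and $d=\sum_\alpha d_\alpha\Gamma_{I_\alpha}$ with $d_\alpha=\epsilon_\alpha c_\alpha$ for $\epsilon_\alpha\in\{\pm1\}$, $I_\alpha\cap I_\beta=\emptyset$ for $\alpha\neq\beta$, and $\big(\bigcup_\alpha I_\alpha\big)^{\complement}=\emptyset$. Furthermore, let the number of summands in $c$ be bigger than two. Then $(c,d)$ is a non-degenerate quadratic Clifford pair if and only if $\hat I_\alpha$ is even for all $\alpha$ in even dimension, and $\hat I_\alpha$ is even up to one exception in odd dimension. Furthermore, we have $\epsilon_\alpha=(-1)^{\hat I_\alpha}$. In this situation the eigenvalues of $q_{c,d}$ (on $V$) are given by $4\sigma_{I_\alpha}c_\alpha^2$ with multiplicities $\hat I_\alpha$.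
   Context: $V$ is a finite-dimensional real vector space with Euclidean metric $g$; even/odd dimension refers to $\dim V$. $\mathrm{C}\ell(V)$ is its complex Clifford algebra with relation $vw+wv=-2g(v,w)$. $\Gamma_\mu$ denotes (the image under an irreducible matrix representation of) $e_\mu$ in $\mathrm{C}\ell(V)$. For a multi-index $I=(i_1,\dots,i_k)$ of pairwise distinct indices in $\{1,\dots,\dim V\}$ put $\Gamma_I=\Gamma_{i_1}\cdots\Gamma_{i_k}$, $\hat I=k$, and let $\sigma_I\in\{\pm1\}$ be defined by $\Gamma_I^2=\sigma_I 1$; multi-indices are identified with the sets of their entries when set operations are used, and $^\complement$ is the complement in $\{1,\dots,\dim V\}$. The $c_\alpha$ are scalars. For $a,b\in \mathrm{C}\ell(V)$ define $q_{a,b}(x)=a^2x+xb^2-2axb$. A pair $(a,b)$ is a quadratic Clifford pair if $q_{a,b}(V)\subset V$ and $q_{a,b}|_V$ is a $g$-symmetric endomorphism of $V$; it is non-degenerate if $q_{a,b}|_V$ is non-degenerate.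
   Formalization: Scalars are complex; the ''if'' direction also assumes all c_α² real and ε_α=(-1)^{Î_α}, as otherwise q(V)⊄V or the pair fails. Summands are genuine: c_α≠0 and each I_α nonempty (with empty I the sign claim fails, e.g. 1±(Γ_12+Γ_34)). *)

(* Defs.v *)
From HB Require Import structures.
From mathcomp Require Import all_boot all_order all_algebra.
From mathcomp Require Import complex.
From mathcomp Require Import reals.

Set Implicit Arguments.
Unset Strict Implicit.
Unset Printing Implicit Defensive.

Import Order.TTheory GRing.Theory Num.Theory.
Local Open Scope ring_scope.
Local Open Scope complex_scope.

Section CliffordAlgebra.
Variables (R : realType) (V : vectType R) (g : {dot V for idfun}).

Definition clifford_relation (A : algType R[i]) (iota : V -> A) : Prop :=
  forall v w : V,
    iota v * iota w + iota w * iota v = ((- 2 * g v w)%:C)%:A.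

(* The complex Clifford algebra of (V, g), by its universal property among the
   real-linear maps from V to complex algebras satisfying the relation.  An
   algType is nontrivial, so that only the zero algebra is left out as a
   target. *)
Definition is_clifford_algebra (A : algType R[i])
    (iota : {linear V -> A | (real_complex R \; *:%R)}) : Prop :=
  clifford_relation iota /\
  forall (B : algType R[i])
         (f : {linear V -> B | (real_complex R \; *:%R)}),
    clifford_relation f ->
    exists h : {lrmorphism A -> B},
      (forall v, h (iota v) = f v) /\
      forall h' : {lrmorphism A -> B},
        (forall v, h' (iota v) = f v) -> h' =1 h.

(* The matrices act on column vectors, whereas mathcomp encodes a subspace as a
   row space: hence the transpose. *)
Definition irreducible_rep (A : algType R[i]) (N : nat)
    (rho : {lrmorphism A -> 'M[R[i]]_N.+1}) : Prop :=
  forall U : 'M[R[i]]_N.+1,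
    (forall a : A, stablemx U (rho a)^T) -> U = 0 \/ row_full U.

(* The algebra in which the Gamma_mu live, with the embedding of V: either the
   Clifford algebra itself or its image under an irreducible matrix
   representation, which is not faithful when the dimension of V is odd. *)
Inductive gamma_realization : forall B : algType R[i], (V -> B) -> Prop :=
| RealizeClifford (A : algType R[i])
    (iota : {linear V -> A | (real_complex R \; *:%R)}) :
    is_clifford_algebra iota -> gamma_realization iota
| RealizeIrreducible (A : algType R[i])
    (iota : {linear V -> A | (real_complex R \; *:%R)}) (N : nat)
    (rho : {lrmorphism A -> 'M[R[i]]_N.+1}) :
    is_clifford_algebra iota -> irreducible_rep rho ->
    gamma_realization (fun v => rho (iota v)).

Section QuadraticPairs.
Variables (B : algType R[i]) (iota : V -> B).

Definition q_map (a b x : B) : B := a ^+ 2 * x + x * b ^+ 2 - 2 * (a * x * b).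

(* q_{a,b} maps V into V and f is its restriction to V. *)
Definition q_restricts_to (a b : B) (f : 'End(V)) : Prop :=
  forall v : V, q_map a b (iota v) = iota (f v).

Definition g_symmetric (f : 'End(V)) : Prop :=
  forall v w : V, g (f v) w = g v (f w).

Definition quadratic_clifford_pair (a b : B) : Prop :=
  exists f : 'End(V), q_restricts_to a b f /\ g_symmetric f.

Definition nondegenerate_quadratic_clifford_pair (a b : B) : Prop :=
  quadratic_clifford_pair a b /\
  forall f : 'End(V), q_restricts_to a b f -> lker f = 0%VS.

Definition Gamma (n : nat) (e : n.-tuple V) (I : seq 'I_n) : B :=
  \prod_(i <- I) iota (tnth e i).

Definition Gamma_sum (n : nat) (e : n.-tuple V) (m : nat)
    (I : 'I_m -> seq 'I_n) (c : 'I_m -> R[i]) : B :=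
  \sum_(alpha < m) c alpha *: Gamma e (I alpha).
End QuadraticPairs.

End CliffordAlgebra.

(* Main.v *)
Require Import Defs.
From HB Require Import structures.
From mathcomp Require Import all_boot all_order all_algebra.
From mathcomp Require Import complex ring.
From mathcomp Require Import reals.

Set Implicit Arguments.
Unset Strict Implicit.
Unset Printing Implicit Defensive.

Import Order.TTheory GRing.Theory Num.Theory.
Local Open Scope ring_scope.
Local Open Scope complex_scope.

(* Only the Clifford relations in a nontrivial algebra matter.  Writing
   E_a = c_a Gamma_(I_a), the element q(Gamma_i) is Gamma_i times a scalar plus a
   combination of the products E_a E_a', and conjugation by the Gamma_j, which
   acts on each of these by signs, separates them up to complementary pairs of
   blocks.  Asking q(Gamma_i) to be a vector for i inside and outside the two
   blocks then forces eps_a = (-1)^|I_a| and at most one odd block, except when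
   all odd blocks are singletons.  In that case either some x with c x = x d lies
   in the kernel of q, or q is not symmetric.  Conversely, under the parity and
   sign conditions c Gamma_i - Gamma_i d = -2 (-1)^|I_a| Gamma_i E_a for i in I_a,
   and all the E_a commute; since q(x) = c (c x - x d) - (c x - x d) d, this gives
   q(Gamma_i) = 4 E_a^2 Gamma_i. *)

Local Notation sg b := ((-1) ^+ nat_of_bool b).

(** * Sums of disjoint products of generators *)

Section CliffordRelations.
Variables (F : numFieldType) (B : algType F) (n : nat) (G : 'I_n -> B).
Hypothesis G_sqr : forall i, G i * G i = -1.
Hypothesis G_anti : forall i j, i != j -> G i * G j = - (G j * G i).

Lemma G_comm (i j : 'I_n) : G i * G j = sg (i != j) *: (G j * G i).
Proof.
by case: eqVneq => [-> | /G_anti ->] /=; rewrite ?expr1 ?scaleN1r ?expr0 ?scale1r.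
Qed.

Lemma G_prod_comm (j : 'I_n) (I : seq 'I_n) : uniq I ->
  G j * \prod_(i <- I) G i =
    sg (odd (size I) (+) (j \in I)) *: (\prod_(i <- I) G i * G j).
Proof.
elim: I => [_|i I IHI /= /andP[iI uI]].
  by rewrite big_nil mulr1 mul1r scale1r.
rewrite big_cons mulrA G_comm -scalerAl -[in LHS]mulrA IHI // -scalerAr scalerA -mulrA.
congr (_ *: _); rewrite -signr_addb inE; congr (sg _).
by case: eqVneq => [->|_] /=; rewrite ?(negbTE iI); case: (odd _); case: (j \in I).
Qed.

Lemma G_prod_prod_comm (I J : seq 'I_n) : uniq J -> ~~ has (mem J) I ->
  \prod_(i <- I) G i * \prod_(j <- J) G j =
    sg (odd (size I) && odd (size J))
      *: (\prod_(j <- J) G j * \prod_(i <- I) G i).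
Proof.
move=> uJ; elim: I => [_|i I IHI /=].
  by rewrite big_nil mulr1 mul1r scale1r.
rewrite negb_or => /andP[iJ IJ]; rewrite big_cons -mulrA IHI // -scalerAr.
rewrite [in LHS]mulrA G_prod_comm // -scalerAl scalerA mulrA; congr (_ *: _).
rewrite -signr_addb; congr (sg _); rewrite (negbTE iJ : (i \in J) = false).
by case: (odd (size I)); case: (odd (size J)).
Qed.

(* Conjugation by G j acts on x t by the sign chi t j, and distinct characters
   are separated one generator at a time. *)
Lemma isotypic_sum0 (T : finType) (x : T -> B) (chi : T -> 'I_n -> bool)
    (psi : 'I_n -> bool) :
    (forall t j, G j * x t = sg (chi t j) *: (x t * G j)) ->
    \sum_t x t = 0 ->
  \sum_(t | [forall j, chi t j == psi j]) x t = 0.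
Proof.
move=> Gx x0.
have sub (s : seq 'I_n) : \sum_(t | all (fun j => chi t j == psi j) s) x t = 0.
  elim: s => [|j s IHs] //=.
  have conj0 : \sum_(t | all (fun j => chi t j == psi j) s)
                 sg (chi t j (+) psi j) *: x t = 0.
    have: - (G j * (\sum_(t | all (fun j => chi t j == psi j) s) x t) * G j)
          = 0 by rewrite IHs mulr0 mul0r oppr0.
    rewrite mulr_sumr mulr_suml -sumrN => /(congr1 ( *:%R (sg (psi j)))).
    rewrite scaler0 scaler_sumr => H0; rewrite -[RHS]H0; apply: eq_bigr => t _.
    rewrite Gx -scalerAl -mulrA G_sqr mulrN1 !scalerN opprK scalerA -signr_addb.
    by rewrite addbC.
  (* Adding the conjugated sum doubles the terms whose sign at j is [psi j] and cancels the
     others. *)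
  have: \sum_(t | all (fun j => chi t j == psi j) s)
          (x t + sg (chi t j (+) psi j) *: x t) = 0.
    by rewrite big_split /= conj0 IHs addr0.
  rewrite (bigID (fun t => chi t j == psi j)) /= [X in _ + X]big1 => [|t].
    rewrite addr0 => sum0; apply: (@scalerI _ _ (2 : F)).
      by rewrite pnatr_eq0.
    rewrite scaler0 -[RHS]sum0 scaler_sumr; apply: eq_big => [t|t].
      by rewrite andbC.
    by case/andP => /eqP-> _; rewrite addbb scale1r -mulr2n scaler_nat.
  by case/andP => _; case: (chi t j); case: (psi j) => //= _;
     rewrite scaleN1r subrr.
rewrite -[RHS](sub (enum 'I_n)); apply: eq_bigl => t.
by apply/forallP/allP => [H j _|H j]; [exact: H | apply: H; rewrite mem_enum].
Qed.

Definition vec (x : 'I_n -> F) : B := \sum_k x k *: G k.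

Lemma vec_anticomm (x : 'I_n -> F) k :
  vec x * G k + G k * vec x = (-2 * x k)%:A.
Proof.
rewrite mulr_suml mulr_sumr -big_split /= (bigD1 k) //= big1 => [|i ik].
  rewrite addr0 -scalerAl -scalerAr G_sqr -scalerDr mulrC -scalerA.
  by rewrite scaleNr scaler_nat mulr2n opprD.
by rewrite -scalerAl -scalerAr -scalerDr (G_anti ik) addNr scaler0.
Qed.

Lemma alg_inj (x y : F) : x%:A = y%:A :> B -> x = y.
Proof.
move/eqP; rewrite -subr_eq0 -scalerBl scaler_eq0 oner_eq0 orbF subr_eq0.
by move/eqP.
Qed.

(** The anticommutator with [G k] isolates the coefficient at k, so the generators stay independent
    in every nontrivial algebra that satisfies the relations. *)
Lemma vec_inj (x y : 'I_n -> F) : vec x = vec y -> x =1 y.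
Proof.
have n2 : -2 != 0 :> F by rewrite oppr_eq0 pnatr_eq0.
move=> xy k; apply/esym/(mulfI n2)/alg_inj.
by rewrite -!vec_anticomm xy.
Qed.


(** * Disjoint blocks, abstracted to their commutation signs and scalar squares *)

Section Blocks.
Variables (m : nat) (b : 'I_n -> 'I_m) (p eb : 'I_m -> bool) (w : 'I_m -> F)
  (E : 'I_m -> B).
Hypothesis m_gt2 : (2 < m)%N.
Hypothesis b_surj : forall a, exists i, b i = a.
Hypothesis G_E : forall j a, G j * E a = sg (p a (+) (b j == a)) *: (E a * G j).
Hypothesis E_comm : forall a a', a != a' ->
  E a * E a' = sg (p a && p a') *: (E a' * E a).
Hypothesis w_neq0 : forall a, w a != 0.
Hypothesis E_sqr : forall a, E a * E a = (w a)%:A.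

(* The sign by which G j commutes past E a * E a'. *)
Definition chi (a a' : 'I_m) (j : 'I_n) :=
  (p a (+) (b j == a)) (+) (p a' (+) (b j == a')).

Lemma G_EE j a a' : G j * (E a * E a') = sg (chi a a' j) *: (E a * E a' * G j).
Proof.
rewrite [in LHS]mulrA G_E -scalerAl -[in LHS]mulrA G_E -scalerAr scalerA mulrA.
by rewrite -signr_addb.
Qed.

Lemma E_neq0 a k : k *: E a = 0 -> k = 0.
Proof.
move/(congr1 (fun x => x * E a)); rewrite mul0r -scalerAl E_sqr scalerA => /eqP.
by rewrite scaler_eq0 oner_eq0 orbF mulf_eq0 (negbTE (w_neq0 a)) orbF => /eqP.
Qed.

Lemma EE_neq0 a a' k : k *: (E a * E a') = 0 -> k = 0.
Proof.
move/(congr1 (fun x => x * E a')).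
rewrite mul0r -scalerAl -mulrA E_sqr -scalerAr mulr1 scalerA.
by move/E_neq0/eqP; rewrite mulf_eq0 (negbTE (w_neq0 a')) orbF => /eqP.
Qed.

Lemma exists_third (a a' : 'I_m) : exists a'', (a'' != a) && (a'' != a').
Proof.
have: (0 < #|~: [set a; a']|)%N.
  rewrite cardsCs setCK card_ord subn_gt0; apply: leq_ltn_trans m_gt2.
  by rewrite cards2; case: (_ != _).
by case/card_gt0P => a''; rewrite !inE negb_or => ?; exists a''.
Qed.

(** A square has the trivial character, whereas [chi a a'] takes opposite values on block a and on a
    third block. *)
Lemma chi_neq_diag a a' a'' : a != a' -> ~ chi a'' a'' =1 chi a a'.
Proof.
move=> aa' H; have [c /andP[ca ca']] := exists_third a a'.
have [i bi] := b_surj a; have [k bk] := b_surj c.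
have := H i; have := H k; rewrite /chi !addbb bi bk.
rewrite (negbTE ca) (negbTE ca') eqxx (negbTE aa').
by case: (p a); case: (p a').
Qed.

(** In the isotypic component of [chi a a'] the terms [x t] are absent and the other pairs cancel,
    which leaves one multiple of [E a * E a']. *)
Lemma pair_coef0 (k : 'I_m -> 'I_m -> F) (T : finType) (x : T -> B)
    (chiT : T -> 'I_n -> bool) (a a' : 'I_m) :
    (forall t j, G j * x t = sg (chiT t j) *: (x t * G j)) ->
    \sum_c \sum_c' k c c' *: (E c * E c') + \sum_t x t = 0 ->
    a != a' ->
    (forall t, ~ chiT t =1 chi a a') ->
    (forall c c', c != c' -> chi c c' =1 chi a a' ->
      (c, c') != (a, a') -> (c, c') != (a', a) ->
      k c c' + sg (p c && p c') * k c' c = 0) ->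
  k a a' + sg (p a && p a') * k a' a = 0.
Proof.
move=> Gx sum0 aa' chiTP kP.
pose X (t : ('I_m * 'I_m) + T) :=
  match t with inl c => k c.1 c.2 *: (E c.1 * E c.2) | inr t => x t end.
pose chiX (t : ('I_m * 'I_m) + T) :=
  match t with inl c => chi c.1 c.2 | inr t => chiT t end.
have GX t j : G j * X t = sg (chiX t j) *: (X t * G j).
  case: t => [[c c']|t] //=; rewrite -scalerAr G_EE -scalerAl !scalerA.
  by rewrite mulrC.
have X0 : \sum_t X t = 0.
  by rewrite big_sumType /= -[RHS]sum0 pair_bigA.
have := isotypic_sum0 (chi a a') GX X0; rewrite big_sumType /=.
rewrite [X in _ + X]big_pred0 => [|t]; last first.
  by apply/negP => /forallP H; apply: (chiTP t) => j; apply/eqP/H.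
rewrite addr0 => S0.
have chiC c c' : chi c c' =1 chi c' c by move=> j; rewrite /chi addbC.
(* Adding the sum over swapped pairs lets the two orders of a pair be merged under one coefficient.
   Both (a, a') and (a', a) then contribute equally, whence the factor 2 removed at the end. *)
have: \sum_(c | [forall j, chi c.1 c.2 j == chi a a' j])
        (k c.1 c.2 *: (E c.1 * E c.2) + k c.2 c.1 *: (E c.2 * E c.1)) = 0.
  rewrite big_split /= S0 add0r -[RHS]S0.
  rewrite (reindex_inj (h := fun c => (c.2, c.1))) /=; last first.
    by move=> [? ?] [? ?] [-> ->].
  by apply: eq_bigl => c; apply: eq_forallb => j; rewrite chiC.
have -> : \sum_(c | [forall j, chi c.1 c.2 j == chi a a' j])
        (k c.1 c.2 *: (E c.1 * E c.2) + k c.2 c.1 *: (E c.2 * E c.1)) =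
   \sum_(c | [forall j, chi c.1 c.2 j == chi a a' j])
        ((k c.1 c.2 + sg (p c.1 && p c.2) * k c.2 c.1) *: (E c.1 * E c.2)).
  apply: eq_bigr => -[c c'] /forallP /= cc'.
  have [ecc'|ncc'] := eqVneq c c'.
    by case: (@chi_neq_diag a a' c aa') => j; apply/eqP; rewrite -(eqP (cc' j)) ecc'.
  rewrite (@E_comm c' c) 1?eq_sym // scalerA scalerDl andbC.
  by rewrite mulrC.
rewrite (bigD1 (a, a')) /=; last by apply/forallP => j.
rewrite (bigD1 (a', a)) /=; last first.
  rewrite xpair_eqE negb_and (eq_sym a') aa' andbT.
  by apply/forallP => j; rewrite chiC.
rewrite big1 ?addr0 => [|[c c'] /andP[/andP[/forallP H H1] H2]]; last first.
  rewrite /= in H; rewrite kP ?scale0r //.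
    apply/eqP => /= ecc'; apply: (@chi_neq_diag a a' c aa') => j.
    by apply/eqP; rewrite -(eqP (H j)) ecc'.
  by move=> j; apply/eqP.
rewrite (@E_comm a' a) 1?eq_sym // scalerA -scalerDl => /EE_neq0.
have s1 : sg (p a && p a') * sg (p a && p a') = 1 :> F.
  by rewrite -signr_addb addbb.
rewrite [p a' && _]andbC => H.
apply/eqP; have /= <- := mulrn_eq0 (k a a' + sg (p a && p a') * k a' a) 2.
rewrite -[X in _ == X]H mulr2n; apply/eqP.
by congr (_ + _); rewrite mulrDl mulrAC s1 mul1r addrC mulrC.
Qed.

(* eps_a <> (-1)^|I_a| *)
Definition signs_differ (a : 'I_m) := p a (+) eb a.
Local Notation v := signs_differ.

Let cc := \sum_a E a.
Let dd := \sum_a sg (eb a) *: E a.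
Definition qE (x : B) := cc * (cc * x - x * dd) - (cc * x - x * dd) * dd.

(* When [flips i a] is false, E a * G i = eps_a G i * E a. *)
Definition flips (i : 'I_n) (a : 'I_m) := v a (+) (b i == a).
Definition pair_coef (i : 'I_n) (a a' : 'I_m) : F :=
  sg (p a (+) (b i == a)) * (sg (p a' (+) (b i == a')) - sg (eb a'))
    - (sg (p a (+) (b i == a)) - sg (eb a)) * sg (eb a').

(** With f_a = (-1)^([flips i a]), [pair_coef i a a'] equals eps_a eps_a' (f_a f_a' - 2 f_a + 1). Up
    to the factor eps_a eps_a', symmetrizing gives 2 (1 - f_a) (1 - f_a') and antisymmetrizing gives
    2 (f_a' - f_a). *)
Lemma pair_coef_sym i a a' :
  pair_coef i a a' + sg (p a && p a') * pair_coef i a' a =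
  4 * sg (eb a (+) eb a') *
    (if p a && p a' then (flips i a)%:R - (flips i a')%:R
     else 2 * (flips i a && flips i a')%:R).
Proof.
rewrite /pair_coef /flips /signs_differ.
by case: (p a); case: (p a'); case: (eb a); case: (eb a');
   case: (b i == a); case: (b i == a') => /=; ring.
Qed.

Lemma E_G i a : E a * G i = sg (p a (+) (b i == a)) *: (G i * E a).
Proof. by rewrite G_E scalerA -signr_addb addbb scale1r. Qed.

Lemma cc_G i : cc * G i = G i * \sum_a sg (p a (+) (b i == a)) *: E a.
Proof.
rewrite mulr_suml mulr_sumr; apply: eq_bigr => a _.
by rewrite E_G scalerAr.
Qed.

Lemma comm_defect i : cc * G i - G i * dd =
  G i * \sum_a (sg (p a (+) (b i == a)) - sg (eb a)) *: E a.
Proof.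
rewrite cc_G -mulrBr -sumrB; congr (_ * _).
by apply: eq_bigr => a _; rewrite scalerBl.
Qed.

Lemma qE_G i : qE (G i) = G i * \sum_a \sum_a' pair_coef i a a' *: (E a * E a').
Proof.
rewrite /qE comm_defect mulrA cc_G -!mulrA -mulrBr; congr (_ * _).
rewrite !mulr_suml -sumrB; apply: eq_bigr => a _.
rewrite !mulr_sumr -sumrB; apply: eq_bigr => a' _.
by rewrite -!scalerAl -!scalerAr !scalerA -scalerBl.
Qed.

(* E c * E c' and E a * E a' can be proportional in an irreducible representation
   in odd dimension, where the volume element is a scalar; this only happens for
   complementary pairs among four blocks. *)
Lemma pair_collision c c' a a' : a != a' -> c != c' -> chi c c' =1 chi a a' ->
    (c, c') != (a, a') -> (c, c') != (a', a) ->
  [/\ [&& a != c, a != c', a' != c & a' != c'],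
      p c (+) p c' = ~~ (p a (+) p a')
    & forall e, [|| e == a, e == a', e == c | e == c']].
Proof.
rewrite !xpair_eqE => aa' cc' eqchi n1 n2.
have H e : p c (+) (e == c) (+) (p c' (+) (e == c')) =
           p a (+) (e == a) (+) (p a' (+) (e == a')).
  by have [i <-] := b_surj e; exact: eqchi.
have := H a; have := H a'; have := H c; have := H c'.
rewrite !eqxx !(eq_sym c) !(eq_sym c') in n1 n2 *; rewrite !(eq_sym a' a).
rewrite (negbTE aa') (negbTE cc').
have x1 : ~~ ((a == c) && (a' == c)).
  by apply/negP => /andP[/eqP ac /eqP a'c]; rewrite ac a'c eqxx in aa'.
have x2 : ~~ ((a == c') && (a' == c')).
  by apply/negP => /andP[/eqP ac /eqP a'c]; rewrite ac a'c eqxx in aa'.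
have x3 : ~~ ((a == c) && (a == c')).
  by apply/negP => /andP[/eqP ac /eqP ac']; rewrite -ac -ac' eqxx in cc'.
have x4 : ~~ ((a' == c) && (a' == c')).
  by apply/negP => /andP[/eqP ac /eqP ac']; rewrite -ac -ac' eqxx in cc'.
move=> h1 h2 h3 h4.
have [N P] : [&& a != c, a != c', a' != c & a' != c'] /\
    p c (+) p c' = ~~ (p a (+) p a').
  move: h1 h2 h3 h4 n1 n2 x1 x2 x3 x4.
  by case: (a == c); case: (a == c'); case: (a' == c); case: (a' == c');
     case: (p a); case: (p a'); case: (p c); case: (p c').
split=> // e; have := H e; move: P.
by case: (e == c); case: (e == c'); case: (e == a); case: (e == a');
   case: (p a); case: (p a'); case: (p c); case: (p c').
Qed.

(** * Constraints on parities and signs when q maps generators to vectors *)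

Definition chiG (i l j : 'I_n) := (j != i) (+) (j != l).

Lemma G_GG j i l : G j * (G i * G l) = sg (chiG i l j) *: (G i * G l * G j).
Proof.
rewrite [in LHS]mulrA (G_comm j i) -scalerAl -[in LHS]mulrA (G_comm j l).
rewrite -scalerAr scalerA mulrA.
by rewrite -signr_addb.
Qed.

Definition fiber_size (a : 'I_m) := #|[pred i | b i == a]|.
Hypothesis p_odd : forall a, p a = odd (fiber_size a).

Lemma fiber_size1 i : (forall j, b j = b i -> j = i) -> fiber_size (b i) = 1%N.
Proof.
move=> bP; rewrite -(card1 i); apply: eq_card => j; rewrite !inE.
by apply/eqP/eqP => [/bP|->].
Qed.

(** A third block excludes i = l, and the sign at i forces equal parities. What remains of the
    equality says that the union of the two blocks is {i, l}. *)
Lemma chiG_in i l a a' : a != a' -> b i = a -> chiG i l =1 chi a a' ->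
  fiber_size a = 1%N /\ fiber_size a' = 1%N.
Proof.
move=> aa' bi H.
have il : i != l.
  apply/eqP => il; have := H i; rewrite -il in H *.
  have [c /andP[ca ca']] := exists_third a a'; have [j bj] := b_surj c.
  have := H j; rewrite /chi /chiG !addbb bi bj eqxx (negbTE aa').
  by rewrite (negbTE ca) (negbTE ca'); case: (p a); case: (p a').
have pp : p a (+) p a' = false.
  have := H i; rewrite /chi /chiG bi !eqxx il (negbTE aa').
  by case: (p a); case: (p a').
have inP j : (b j == a) (+) (b j == a') = (j == i) (+) (j == l).
  have := H j; rewrite /chi /chiG; move: pp.
  by case: (p a); case: (p a'); case: (b j == a); case: (b j == a');
     case: (j == i); case: (j == l).
have [j bj] := b_surj a'.
have jl : j = l.
  have := inP j; rewrite bj eqxx [a' == a]eq_sym (negbTE aa').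
  case: (eqVneq j i) => [ji|_ /esym/eqP //].
  by rewrite -bi -bj ji eqxx in aa'.
have bl : b l = a' by rewrite -jl.
split; first (rewrite -bi; apply: fiber_size1 => h bh; have := inP h).
  rewrite bh bi eqxx (negbTE aa'); case: (eqVneq h i) => // _ /esym/eqP hl.
  by rewrite -bi -bh hl bl eqxx in aa'.
rewrite -bl; apply: fiber_size1 => h bh; have := inP h.
rewrite bh bl eqxx [a' == a]eq_sym (negbTE aa'); case: (eqVneq h l) => //.
by case: (eqVneq h i) => // hi; rewrite -bi -hi bh bl eqxx in aa'.
Qed.

(** The characters differ on block a if i = l, and at i itself otherwise. *)
Lemma chiG_out i l a a' : a != a' -> b i != a -> b i != a' -> p a = p a' ->
  ~ chiG i l =1 chi a a'.
Proof.
move=> aa' ia ia' pp H.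
have [il|il] := eqVneq i l.
  have [j bj] := b_surj a; have := H j.
  by rewrite /chi /chiG il bj !eqxx (negbTE aa') pp; case: (p a'); case: (_ == _).
have := H i; rewrite /chi /chiG eqxx il (negbTE ia) (negbTE ia') pp.
by case: (p a').
Qed.

Variable M : 'I_n -> 'I_n -> F.
Hypothesis qE_vec : forall i, qE (G i) = vec (M i).

(** Multiplying q([G i]) by [G i] gives a linear relation among products that each commute with the
    generators up to a sign. *)
Lemma pair_expansion i :
  \sum_a \sum_a' pair_coef i a a' *: (E a * E a') + \sum_l M i l *: (G i * G l) = 0.
Proof.
have := qE_vec i; rewrite qE_G => /(congr1 (fun x => G i * x)).
rewrite mulrA G_sqr mulN1r mulr_sumr => H; rewrite -[X in X + _]opprK H.
by rewrite -sumrN -big_split big1 //= => l _; rewrite -scalerAr addNr.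
Qed.

(* Compare q(G i) and q(G j) for i in block a and j in block a': a pair of blocks
   disjoint from a and a' contributes equally to both, so that a complementary
   pair cancels in the difference. *)
Lemma pair_inside a a' : a != a' ->
    ~ (fiber_size a = 1%N /\ fiber_size a' = 1%N) ->
  v a' = v a (+) (p a && p a').
Proof.
move=> aa' nsing; have [i bi] := b_surj a; have [j bj] := b_surj a'.
pose x (s : 'I_n + 'I_n) :=
  match s with inl l => M i l *: (G i * G l)
             | inr l => - M j l *: (G j * G l) end.
pose chix (s : 'I_n + 'I_n) :=
  match s with inl l => chiG i l | inr l => chiG j l end.
have kk : pair_coef i a a' - pair_coef j a a'
    + sg (p a && p a') * (pair_coef i a' a - pair_coef j a' a) = 0.
  apply: (@pair_coef0 (fun a a' => pair_coef i a a' - pair_coef j a a') _ x chix) => //.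
  - by case=> l h /=; rewrite -scalerAr G_GG -scalerAl !scalerA mulrC.
  - have := pair_expansion i; have := pair_expansion j.
    move=> /(congr1 -%R); rewrite oppr0 opprD -!sumrN => Hj Hi.
    have := congr2 +%R Hi Hj; rewrite addr0 => Hij; rewrite -[RHS]Hij.
    rewrite big_sumType /= [in RHS]addrACA -[in RHS]big_split /=; congr (_ + (_ + _)).
      apply: eq_bigr => c _; rewrite -sumrN -big_split /=; apply: eq_bigr => c' _.
      by rewrite scalerBl.
    by apply: eq_bigr => l _; rewrite scaleNr.
  - case=> l /= H; apply: nsing; first exact: chiG_in aa' bi H.
    have := chiG_in _ bj; case/(_ l a); rewrite 1?eq_sym // => h.
    by rewrite H /chi addbC.
  move=> c c' cc' ecc n1 n2; have [] := pair_collision aa' cc' ecc n1 n2.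
  case/and4P=> ac ac' a'c a'c' _ _.
  rewrite mulrBr addrACA -opprD !pair_coef_sym /flips bi bj.
  by rewrite (negbTE ac) (negbTE ac') (negbTE a'c) (negbTE a'c') subrr.
(* The difference now depends on [v a] and [v a'] only: for two odd blocks it vanishes exactly when
   they differ, otherwise exactly when they agree. *)
move: kk; rewrite mulrBr addrACA -opprD !pair_coef_sym -mulrBr => /eqP.
rewrite !mulf_eq0 pnatr_eq0 signr_eq0 /= /flips bi bj !eqxx [a' == a]eq_sym.
rewrite (negbTE aa').
have n4 : (1 + 1 == 0 :> F) = false by apply/negbTE; rewrite -mulr2n pnatr_eq0.
case: (p a && p a'); case: (v a); case: (v a') => //=;
  rewrite ?subr0 ?sub0r ?opprK ?mulr1 ?mulr0 ?subr0 ?oppr0 ?addr0 ?add0r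
          ?oppr_eq0 ?pnatr_eq0 -?opprD ?oppr_eq0 ?n4 //.
Qed.

(** Take i in block c. A colliding pair would contain c and have one odd and one even member:
    impossible if all parities agree, and of coefficient 0 if [v c], since then [flips i c] is
    false. *)
Lemma pair_outside a a' c : a != a' -> c != a -> c != a' -> p a = p a' ->
    v c \/ (forall e, p e = p c) ->
  if p a then v a' = v a else ~~ (v a && v a').
Proof.
move=> aa' ca ca' pp vc; have [i bi] := b_surj c.
have: pair_coef i a a' + sg (p a && p a') * pair_coef i a' a = 0.
  apply: (@pair_coef0 (pair_coef i) _ (fun l => M i l *: (G i * G l)) (chiG i)) => //.
  - by move=> l h; rewrite -scalerAr G_GG -scalerAl !scalerA mulrC.
  - exact: pair_expansion.
  - by move=> l; apply: chiG_out => //; rewrite bi.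
  move=> e e' ee' eqe n1 n2; have [] := pair_collision aa' ee' eqe n1 n2.
  rewrite pp addbb => _ pe /(_ c); rewrite (negbTE ca) (negbTE ca') /= => ce.
  case: vc => [vc|pc]; last by rewrite !pc addbb in pe.
  have pp' : p e && p e' = false by move: pe; case: (p e); case: (p e').
  rewrite pair_coef_sym /flips bi pp'.
  by case/orP: ce => /eqP <-; rewrite vc eqxx ?andbF !mulr0.
rewrite pair_coef_sym /flips bi (negbTE ca) (negbTE ca') !addbF -pp andbb => /eqP.
rewrite !mulf_eq0 pnatr_eq0 signr_eq0 /=.
by case: (p a); case: (v a); case: (v a') => //=;
   rewrite ?mulr1 ?subr0 ?sub0r ?oppr_eq0 ?oner_eq0 ?pnatr_eq0.
Qed.

(** * Excluding odd singleton blocks *)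

Variable cf : 'I_m -> F.
Hypothesis cf_neq0 : forall a, cf a != 0.
Hypothesis E_single : forall i, fiber_size (b i) = 1%N ->
  E (b i) = cf (b i) *: G i.

Lemma sum_singletons (P : pred 'I_m) :
  (forall a, P a -> fiber_size a = 1%N) ->
  \sum_(a | P a) E a = vec (fun i => (P (b i))%:R * cf (b i)).
Proof.
move=> P1; rewrite /vec [RHS](bigID (fun i => P (b i))) /= [X in _ + X]big1 ?addr0.
  rewrite (partition_big b P) //=; apply: eq_bigr => a Pa.
  have fa : #|[pred i | P (b i) & b i == a]| = 1%N.
    rewrite -(P1 a Pa); apply: eq_card => i; rewrite !inE.
    by case: eqVneq => [->|]; rewrite ?andbF // Pa.
  rewrite -[LHS]mulr1n -fa -sumr_const; apply/esym.
  apply: eq_big => [i|i /andP[Pi /eqP bi]]; first by rewrite inE.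
  by rewrite Pi mul1r -E_single ?bi // P1.
by move=> i /negbTE ->; rewrite mul0r scale0r.
Qed.

(** For every block without i, eps_a is exactly the sign of commutation with [G i], so only the
    block of i contributes. *)
Lemma comm_defect_eq i : (forall a, v a = false) ->
  cc * G i - G i * dd = (-2 * sg (p (b i))) *: (G i * E (b i)).
Proof.
move=> v0; have ebp a : eb a = p a.
  by have := v0 a; rewrite /signs_differ; case: (p a); case: (eb a).
rewrite comm_defect (bigD1 (b i)) //= big1 ?addr0 => [|a /negbTE ia].
  rewrite -scalerAr eqxx addbT ebp; congr (_ *: _).
  by case: (p (b i)) => /=; ring.
by rewrite eq_sym ia addbF ebp subrr scale0r.
Qed.

Hypothesis M_sym : forall i j, M i j = M j i.
Hypothesis qE_inj : forall x, qE (vec x) = 0 -> forall i, x i = 0.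

Lemma qE_eq0 x : cc * x = x * dd -> qE x = 0.
Proof. by rewrite /qE => ->; rewrite subrr mulr0 mul0r subrr. Qed.

(* For x = c_a' G i - c_a G j, where {i} and {j} are the two blocks, c x = x d. *)
Lemma no_two_singletons a a' : (forall e, v e = false) -> a != a' ->
  fiber_size a = 1%N -> fiber_size a' = 1%N -> False.
Proof.
move=> v0 aa' fa fa'; have [i bi] := b_surj a; have [j bj] := b_surj a'.
have ij : i != j by apply: contra aa' => /eqP ij; rewrite -bi -bj ij.
pose x l := cf a' * (l == i)%:R - cf a * (l == j)%:R.
have vx : vec x = cf a' *: G i - cf a *: G j.
  rewrite /vec (bigD1 i) //= (bigD1 j) 1?eq_sym //= big1 => [|l /andP[li lj]].
    rewrite addr0 /x !eqxx (negbTE ij) [j == i]eq_sym (negbTE ij).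
    by rewrite !mulr1 !mulr0 subr0 sub0r scaleNr.
  by rewrite /x (negbTE li) (negbTE lj) !mulr0 subrr scale0r.
(* For a singleton the defect is a scalar, so two of them can be balanced against each other. *)
have defect l e : b l = e -> fiber_size e = 1%N ->
    cc * G l - G l * dd = (-2 * cf e)%:A.
  move=> <- fe; rewrite comm_defect_eq // E_single // p_odd fe expr1.
  by rewrite -scalerAr G_sqr scalerA scalerN -scaleNr; congr (_ *: _); ring.
suff /qE_inj /(_ i) : qE (vec x) = 0.
  rewrite /x eqxx (negbTE ij) mulr1 mulr0 subr0 => /eqP.
  by rewrite (negbTE (cf_neq0 a')).
apply/qE_eq0/eqP; rewrite -subr_eq0 vx mulrBr mulrBl -!scalerAr -!scalerAl.
have -> : cf a' *: (cc * G i) - cf a *: (cc * G j) -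
    (cf a' *: (G i * dd) - cf a *: (G j * dd)) =
    cf a' *: (cc * G i - G i * dd) - cf a *: (cc * G j - G j * dd).
  by rewrite !scalerBr !opprD addrACA.
rewrite (defect i a) // (defect j a') // !scalerA mulrCA [cf a * _]mulrCA.
by rewrite [cf a' * _]mulrC subrr.
Qed.

(** Here every eps_a is 1, so d = c is itself a non-zero vector, and x = c satisfies c x = x d. *)
Lemma not_all_singletons : (forall a, v a) ->
  (forall a, fiber_size a = 1%N) -> False.
Proof.
move=> v1 f1.
have ccE : cc = vec (fun i => cf (b i)).
  rewrite /cc (@sum_singletons predT) //; apply: eq_bigr => i _.
  by rewrite mul1r.
have dcc : dd = cc.
  apply: eq_bigr => a _; have := v1 a.
  by rewrite /signs_differ p_odd f1; case: (eb a) => // _; rewrite scale1r.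
have [i _] := b_surj (Ordinal (ltnW (ltnW m_gt2))).
suff /qE_inj /(_ i) /eqP : qE (vec (fun i => cf (b i))) = 0.
  by rewrite (negbTE (cf_neq0 _)).
by apply: qE_eq0; rewrite dcc -ccE.
Qed.

(* With E := E g and s the sum of the other terms, q(x) is
   4 E^2 x + 4 s^2 x + 4 y s + 4 E [s, x] for x a generator outside block g,
   with coefficient y in s.
   Symmetry of q makes the pairing of E [s, x] with the generators symmetric,
   while it is skew by inspection; hence [s, x] = 0. *)
Lemma singletons_but_one g a0 a1 : (forall a, v a) -> ~~ p g ->
  (forall a, a != g -> fiber_size a = 1%N) ->
  a0 != g -> a1 != g -> a0 != a1 -> False.
Proof.
move=> v1 /negbTE pg f1 a0g a1g a01.
pose s := \sum_(a | a != g) E a.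
pose y l := (b l != g)%:R * cf (b l).
have sE : s = vec y by rewrite /s (sum_singletons f1).
have ps a : a != g -> p a by move=> ag; rewrite p_odd f1.
have ccE : cc = E g + s by rewrite /cc (bigD1 g).
(* As every v holds, eps is 1 on the odd singletons and -1 on the even block g. *)
have ddE : dd = s - E g.
  rewrite /dd (bigD1 g) //= addrC; congr (_ + _).
    apply: eq_bigr => a /ps pa; have := v1 a; rewrite /signs_differ pa.
    by case: (eb a) => //= _; rewrite scale1r.
  have := v1 g; rewrite /signs_differ pg /= => ->.
  by rewrite expr1 scaleN1r.
have Eg_s : E g * s = s * E g.
  rewrite mulr_sumr mulr_suml; apply: eq_bigr => a ag.
  by rewrite E_comm 1?eq_sym // pg scale1r.
have Eg_in l : b l = g -> E g * G l = - (G l * E g).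
  by move=> bl; rewrite E_G pg bl eqxx expr1 scaleN1r.
have Eg_out l : b l != g -> E g * G l = G l * E g.
  by move=> /negbTE bl; rewrite E_G pg bl scale1r.
have s_G l : s * G l + G l * s = (-2 * y l)%:A by rewrite sE vec_anticomm.
have s_in l : b l = g -> s * G l = - (G l * s).
  by move=> bl; apply/eqP; rewrite -addr_eq0 s_G /y bl eqxx mul0r mulr0 scale0r.
have [S s_sqr] : exists S, s * s = S%:A.
  exists (- \sum_l y l * y l).
  apply: (@scalerI _ _ (2 : F)); first by rewrite pnatr_eq0.
  rewrite scaler_nat mulr2n {1 4}sE /vec mulr_suml mulr_sumr -big_split /=.
  rewrite scalerA mulrN mulr_sumr -sumrN scaler_suml; apply: eq_bigr => l _.
  rewrite -scalerAl -scalerAr -scalerDr addrC s_G scalerA; congr (_ *: _).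
  by ring.
pose h l := s * G l - G l * s.
have qG l : b l != g ->
    qE (G l) = (4 * w g + 4 * S) *: G l + (4 * y l) *: s + 4 *: (E g * h l).
  move=> lg; move: (Eg_out l lg) (s_G l); rewrite /h.
  move: (G l) (E g) Eg_s (E_sqr g) ccE ddE => x e es ee ce de ex sx.
  have esx : s * x * e = e * (s * x) by rewrite -mulrA -ex mulrA -es mulrA.
  have exs : x * s * e = e * (x * s) by rewrite -mulrA -es mulrA -ex mulrA.
  have defect : cc * x - x * dd = 2 *: (e * x) + (s * x - x * s).
    by rewrite ce de mulrDl mulrBr -ex opprB addrACA scaler_nat mulr2n.
  have eex : e * (e * x) = w g *: x by rewrite mulrA ee -scalerAl mul1r.
  have ssx : s * (s * x) = S *: x by rewrite mulrA s_sqr -scalerAl mul1r.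
  have sh : s * (s * x - x * s) - (s * x - x * s) * s =
      (4 * S) *: x + (4 * y l) *: s.
    have xs : x * s = (-2 * y l)%:A - s * x by rewrite -sx addrAC subrr add0r.
    have sxs : s * (x * s) = (-2 * y l) *: s - S *: x.
      by rewrite xs mulrBr -scalerAr mulr1 ssx.
    have xss : x * s * s = S *: x by rewrite -mulrA s_sqr -scalerAr mulr1.
    rewrite mulrBr mulrBl ssx -[s * x * s]mulrA sxs xss.
    rewrite (_ : 4 * y l = - (-2 * y l) + - (-2 * y l)); last by ring.
    move: (-2 * y l) => q; rewrite !opprD !opprK -!scaleNr.
    rewrite (_ : 4 * S = S + S + S + S); last by ring.
    by rewrite !scalerDl (AC (1*2*3) ((1*3*5*6)*(2*4))).
  have qh : qE x = 4 *: (e * (e * x)) + 4 *: (e * (s * x - x * s)) +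
      (s * (s * x - x * s) - (s * x - x * s) * s).
    have eH : (s * x - x * s) * e = e * (s * x - x * s).
      by rewrite mulrBl esx exs -mulrBr.
    have sex : s * (e * x) = e * (s * x) by rewrite mulrA -es mulrA.
    rewrite /qE defect ce de.
    move: (mulrBr e (s * x) (x * s)) eH; move: (s * x - x * s) => H eHd eH.
    rewrite mulrDl mulrBr !mulrDr !mulrDl -!scalerAr.
    rewrite -!scalerAl eH sex -[e * x * s]mulrA -[e * x * e]mulrA -ex.
    have -> : 4 *: (e * H) =
        e * H + e * H + (2 *: (e * (s * x)) - 2 *: (e * (x * s))).
      rewrite -scalerBr -eHd -mulr2n -scaler_nat -scalerDl.
      by congr (_ *: _); ring.
    have -> : 4 *: (e * (e * x)) = 2 *: (e * (e * x)) + 2 *: (e * (e * x)).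
      by rewrite -scalerDl; congr (_ *: _); ring.
    by rewrite !opprD !opprK
       (AC ((2*2)*(2*2)) ((1*7)*((2*8)*(3*5))*(4*6))).
  rewrite qh sh eex scalerA scalerDl -!addrA; congr (_ + _).
  by rewrite addrC addrA.
(* What is left of [M] once the symmetric terms of [qG] are removed: for i outside block g, row i
   holds the coordinates of 4 E_g [s, G_i]. *)
pose beta i l := M i l - (4 * w g + 4 * S) * (l == i)%:R - 4 * y i * y l.
have beta_vec i : b i != g -> vec (beta i) = 4 *: (E g * h i).
  move=> ig; have := qG i ig; rewrite qE_vec => Mi.
  have -> : 4 *: (E g * h i) = vec (M i) - (4 * w g + 4 * S) *: G i - (4 * y i) *: s.
    by rewrite -addrA -opprD Mi addrAC subrr add0r.
  rewrite sE /vec scaler_sumr.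
  have -> : G i = \sum_l (l == i)%:R *: G l.
    rewrite (bigD1 i) //= eqxx scale1r big1 ?addr0 // => l /negbTE ->.
    by rewrite scale0r.
  rewrite scaler_sumr -!sumrB; apply: eq_bigr => l _.
  by rewrite !scalerA -!scalerBl.
have beta_sym i l : beta i l = beta l i.
  by rewrite /beta M_sym eq_sym mulrAC.
(* The coordinate is read off by the anticommutator with [G l]. For l in block g it vanishes because
   [h i] commutes and [E g] anticommutes with [G l]; for l outside, the values at (i, l) and (l, i)
   are opposite, against the symmetry of [beta]. *)
have beta0 i l : b i != g -> beta i l = 0.
  move=> ig.
  have bG j r : b j != g ->
      (-2 * beta j r)%:A = 4 *: (E g * h j * G r + G r * (E g * h j)).
    by move=> jg; rewrite -vec_anticomm beta_vec // -scalerAl -scalerAr scalerDr.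
  apply: (mulfI (_ : -2 != 0)); first by rewrite oppr_eq0 pnatr_eq0.
  rewrite mulr0; apply: alg_inj; rewrite scale0r.
  have [lg|lg] := eqVneq (b l) g.
    have hl : h i * G l = G l * h i.
      have il : i != l by apply: contraNneq ig => ->; rewrite lg.
      rewrite /h mulrBl mulrBr; congr (_ - _); rewrite -mulrA.
        by rewrite (G_anti il) mulrN mulrA (s_in l lg) mulNr opprK mulrA.
      by rewrite (s_in l lg) mulrN mulrA (G_anti il) mulNr opprK mulrA.
    by rewrite bG // -mulrA hl !mulrA Eg_in // mulNr addNr scaler0.
  have cent : s * G i * G l + s * G l * G i = G i * G l * s + G l * G i * s.
    rewrite -!mulrA -mulrDr !mulrA -mulrDl; have [->|il] := eqVneq i l.
      by rewrite G_sqr mulrDr mulrDl mulrN1 mulN1r.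
    by rewrite G_anti // addNr mulr0 mul0r.
  have hsum : h i * G l + G l * h i + (h l * G i + G i * h l) = 0.
    rewrite /h !mulrBl !mulrBr !mulrA.
    rewrite (AC ((2*2)*(2*2)) (((1*5)*(4*8))*((2*7)*(3*6)))) /=.
    rewrite addNr subrr !addr0 cent -opprD [X in _ - X]addrC.
    by rewrite subrr.
  apply: (@scalerI _ _ (2 : F)); first by rewrite pnatr_eq0.
  rewrite scaler0 scaler_nat mulr2n {2}beta_sym !bG // -scalerDr.
  rewrite [G l * _]mulrA [G i * _]mulrA -!Eg_out // -!mulrA -!mulrDr hsum.
  by rewrite mulr0 scaler0.
have [i bi] := b_surj a0; have [l bl] := b_surj a1.
have h0 : h i = 0.
  have ig : b i != g by rewrite bi.
  have := beta_vec i ig; rewrite {1}/vec big1 => [|j _]; last first.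
    by rewrite beta0 // scale0r.
  move/esym/eqP; rewrite scaler_eq0 pnatr_eq0 /= => /eqP.
  move=> /(congr1 (fun x => E g * x)).
  rewrite mulrA E_sqr mulr0 -scalerAl mul1r => /eqP.
  by rewrite scaler_eq0 (negbTE (w_neq0 g)) => /eqP.
(* Since s commutes with [G i], the anticommutation relation makes [s * G i] a scalar. The
   coordinate of s at l, different from i, would then be 0. *)
have si : s = y i *: G i.
  have sGi : s * G i = (- y i)%:A.
    apply: (@scalerI _ _ (2 : F)); first by rewrite pnatr_eq0.
    rewrite scaler_nat mulr2n {2}(subr0_eq h0) s_G scalerA; congr (_ *: _).
    by ring.
  have := congr1 (fun x => x * G i) sGi.
  rewrite -mulrA G_sqr mulrN1 -scalerAl mul1r scaleNr => /eqP.
  by rewrite eqr_opp => /eqP.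
have il : i != l by apply: contraNneq a01 => il; rewrite -bi -bl il.
have := s_G l; rewrite si -scalerAl -scalerAr -scalerDr G_anti // addNr.
rewrite scaler0 => /esym/eqP; rewrite scaler_eq0 oner_eq0 orbF mulf_eq0.
rewrite oppr_eq0 pnatr_eq0 /= /y bl a1g mul1r.
by rewrite (negbTE (cf_neq0 _)).
Qed.

(** * Necessity of the parity and sign conditions *)

Theorem pair_necessary :
  (forall a, v a = false) /\ (forall a a', a != a' -> ~~ (p a && p a')).
Proof.
have third (a a' : 'I_m) : exists2 c, c != a & c != a'.
  by have [c /andP[]] := exists_third a a'; exists c.
case: (pickP (fun aa => (aa.1 != aa.2) && (p aa.1 && p aa.2))); last first.
  move=> np.
  have few a a' : a != a' -> p a && p a' = false.
    by move=> aa'; have := np (a, a'); rewrite /= aa'.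
  have v_eq a a' : v a = v a'.
    have [->//|aa'] := eqVneq a a'; rewrite (pair_inside aa') ?few ?addbF //.
    case=> f1 f1'; have := few a a' aa'; by rewrite !p_odd f1 f1'.
  split=> [a|a a' aa']; last by rewrite few.
  apply/negbTE/negP => va.
  have v1 e : v e by rewrite (v_eq e a).
  (* Choose two even blocks and a third block c, the odd one if it exists; [pair_outside] forbids v
     on both even blocks. *)
  have [c [a1 [a2 [a12 ca1 ca2 pa]]]] : exists c a1 a2,
      [/\ a1 != a2, c != a1, c != a2 & p a1 = false /\ p a2 = false].
    case: (pickP p) => [c pc|p0].
      have [a1 a1c _] := third c c; have [a2 a2c a21] := third c a1.
      exists c, a1, a2; rewrite ![c == _]eq_sym [a1 == _]eq_sym; split=> //.
      by have := few a1 c a1c; have := few a2 c a2c; rewrite pc !andbT.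
    have [a1 a1a _] := third a a; have [a2 a2a a21] := third a a1.
    by exists a, a1, a2; rewrite ![a == _]eq_sym [a1 == _]eq_sym !p0; split.
  have := pair_outside a12 ca1 ca2 _ (or_introl (v1 c)).
  by case: pa => -> ->; rewrite !v1 => /(_ erefl).
(* With two odd blocks, v turns out constant and all odd blocks singletons, which the three lemmas
   on singletons exclude. *)
move=> [a a'] /= /and3P[aa' pa pa']; exfalso.
have v_odd e e' : e != e' -> p e -> p e' -> v e = v e' -> fiber_size e = 1%N.
  move=> ee' pe pe' vee'; have [//|fe] := eqVneq (fiber_size e) 1%N.
  have := pair_inside ee'; rewrite pe pe' vee' => H.
  suff: v e' = ~~ v e' by case: (v e').
  by rewrite [LHS]H ?addbT // => -[f1 _]; rewrite f1 in fe.
(* Every block is compared with an even block if there is one; if all are odd, a third block serves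
   as the outside. *)
have v_const : forall e e', v e = v e'.
  case: (pickP (fun e => ~~ p e)) => [g pg|p1].
    have vg e : v e = v g.
      have [->//|eg] := eqVneq e g.
      rewrite (pair_inside eg) ?(negbTE pg) ?andbF ?addbF //.
      by case=> _ fg; rewrite p_odd fg in pg.
    by move=> e e'; rewrite vg [RHS]vg.
  have p1' e : p e by have := p1 e; case: (p e).
  move=> e e'; have [->//|ee'] := eqVneq e e'; have [c ce ce'] := third e e'.
  have := pair_outside ee' ce ce'; rewrite !p1' => /(_ erefl) H.
  by rewrite H //; right=> x; rewrite !p1'.
have f1 e : p e -> fiber_size e = 1%N.
  move=> pe; have [ea|ea] := eqVneq e a.
    by rewrite ea; apply: (v_odd a a').
  exact: (v_odd e a).
have [va|/negbTE va] := boolP (v a); last first.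
  apply: (no_two_singletons (a := a) (a' := a')) => //; try exact: f1.
  by move=> e; rewrite (v_const e a).
have v1 e : v e by rewrite (v_const e a).
case: (pickP (fun e => ~~ p e)) => [g pg|p1]; last first.
  apply: not_all_singletons => // e; apply: f1.
  by have := p1 e; case: (p e).
have ag : a != g by apply: contraNneq pg => <-.
have a'g : a' != g by apply: contraNneq pg => <-.
(* A second even block is ruled out by [pair_outside], seen from block a. *)
apply: (singletons_but_one v1 pg _ ag a'g aa') => e eg; apply: f1.
apply/negPn/negP => pe.
have ae : a != e by apply: contraNneq pe => <-.
have := pair_outside eg ae ag _ (or_introl va).
by rewrite (negbTE pe) (negbTE pg) !v1 => /(_ erefl).
Qed.

(** With at most one odd block the [E a] commute, so E, the product of the block of i, commutes with
    d. The defect k G_i E then arises twice, giving k^2 G_i E^2 with k^2 = 4. *)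
Lemma qE_diag i : (forall a, v a = false) ->
    (forall a a', a != a' -> ~~ (p a && p a')) ->
  qE (G i) = (4 * w (b i)) *: G i.
Proof.
move=> v0 few.
have E_c a a' : E a * E a' = E a' * E a.
  have [->//|aa'] := eqVneq a a'; rewrite E_comm // (negbTE (few _ _ aa')).
  by rewrite scale1r.
have E_dd a : E a * dd = dd * E a.
  rewrite mulr_sumr mulr_suml; apply: eq_bigr => e _.
  by rewrite -scalerAr E_c scalerAl.
rewrite /qE comm_defect_eq // -scalerAr -scalerAl -scalerBr mulrA -[_ * dd]mulrA.
rewrite E_dd mulrA -mulrBl comm_defect_eq // -scalerAl scalerA -[_ * _ * E _]mulrA E_sqr.
rewrite -scalerAr mulr1 scalerA; congr (_ *: _).
by case: (p (b i)) => /=; ring.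
Qed.

End Blocks.

End CliffordRelations.

(** * Restriction to V *)

Section OrthonormalBasis.
Variables (R : realType) (V : vectType R) (g : {dot V for idfun}).
Variables (n : nat) (e : n.-tuple V).
Hypothesis e_basis : basis_of fullv e.
Hypothesis e_orthonormal : orthonormal g e.

Lemma dot_sym u v : g u v = g v u.
Proof. by rewrite hermC expr0 mul1r. Qed.

Lemma dot_basis i j : g (tnth e i) (tnth e j) = (i == j)%:R.
Proof.
case/andP: e_orthonormal => /allP normal ortho.
have ltP k l : (k < l < size e)%N -> g e`_k e`_l = 0.
  elim: (val e) ortho k l => [|u s IHs] /=.
    by move=> _ k l; rewrite ltn0 andbF.
  case/andP; rewrite andbT => /allP us ortho [|k] [|l] //=.
    by rewrite ltnS => ls; apply/eqP/us/mem_nth.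
  by rewrite !ltnS; apply: IHs.
have [->|ij] := eqVneq i j.
  by apply/eqP/normal/mem_tnth.
rewrite !(tnth_nth 0); move: ij; rewrite neq_ltn => /orP[ij|ji].
  by apply: ltP; rewrite ij size_tuple ltn_ord.
by rewrite dot_sym; apply: ltP; rewrite ji size_tuple ltn_ord.
Qed.

Lemma dot_suml (x : 'I_n -> V) v : g (\sum_i x i) v = \sum_i g (x i) v.
Proof. exact: linear_sumlz. Qed.

Lemma dot_sum_basis (x : 'I_n -> R) j :
  g (\sum_i x i *: tnth e i) (tnth e j) = x j.
Proof.
rewrite dot_suml (bigD1 j) //= big1 => [|i ij].
  by rewrite linearZl_LR /= dot_basis eqxx mulr1 addr0.
by rewrite linearZl_LR /= dot_basis (negbTE ij) mulr0.
Qed.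

Lemma basis_expansion v : v = \sum_i g v (tnth e i) *: tnth e i.
Proof.
have := coord_basis e_basis (memvf v).
under eq_bigr do rewrite -tnth_nth.
move=> {1 2}->; apply: eq_bigr => i _.
by rewrite dot_sum_basis.
Qed.

Lemma dim_basis : \dim {:V} = n.
Proof. by rewrite (size_basis e_basis). Qed.

Lemma diag_apply (f : 'End(V)) (lam : 'I_n -> R) v :
    (forall i, f (tnth e i) = lam i *: tnth e i) ->
  f v = \sum_i (lam i * g v (tnth e i)) *: tnth e i.
Proof.
move=> fe; rewrite {1}(basis_expansion v) linear_sum; apply: eq_bigr => i _.
by rewrite linearZ /= fe scalerA mulrC.
Qed.

(** An eigenvector for x has zero coordinates wherever [lam i] differs from x, so the remaining
    basis vectors span the eigenspace. *)
Lemma dim_eigenspace_diag (f : 'End(V)) (lam : 'I_n -> R) x :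
    (forall i, f (tnth e i) = lam i *: tnth e i) ->
  \dim (passmx.leigenspace f x) = #|[pred i | lam i == x]|.
Proof.
move=> fe; pose X := [seq v <- e | f v == x *: v].
have e0 i : tnth e i != 0.
  apply: contra_eq_neq (dot_basis i i) => ->.
  by rewrite eqxx linear0l eq_sym oner_eq0.
have eX i : (f (tnth e i) == x *: tnth e i) = (lam i == x).
  rewrite fe -subr_eq0 -scalerBl scaler_eq0 (negbTE (e0 i)) orbF.
  by rewrite subr_eq0.
have inX v : (v \in passmx.leigenspace f x) = (f v == x *: v).
  by rewrite memv_ker !lfunE /= opp_lfunE scale_lfunE id_lfunE subr_eq0.
have freeX : free X by apply: filter_free; apply: basis_free e_basis.
have -> : passmx.leigenspace f x = <<X>>%VS.
  apply/eqP; rewrite eqEsubv; apply/andP; split; last first.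
    by apply/span_subvP => v; rewrite mem_filter inX => /andP[].
  apply/subvP => v; rewrite inX => /eqP fv.
  rewrite (basis_expansion v); apply: rpred_sum => i _.
  have [lx|lx] := eqVneq (lam i) x.
    by rewrite rpredZ // memv_span // mem_filter eX lx eqxx mem_tnth.
  suff -> : g v (tnth e i) = 0 by rewrite scale0r rpred0.
  have := dot_sum_basis (fun i => lam i * g v (tnth e i)) i.
  rewrite /= -(diag_apply v fe) fv linearZl_LR /= => /eqP.
  rewrite -subr_eq0 -mulrBl mulf_eq0 subr_eq0 eq_sym (negbTE lx) /=.
  by move/eqP.
rewrite (eqP freeX) /X size_filter -(map_tnth_enum e) count_map.
rewrite cardE -size_filter /enum_mem filter_predT; congr size.
by apply: eq_filter => i /=; rewrite eX.
Qed.

Lemma exists_diag (lam : 'I_n -> R) : exists f : 'End(V),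
  (forall i, f (tnth e i) = lam i *: tnth e i) /\ g_symmetric g f.
Proof.
pose f0 v := \sum_i (lam i * g v (tnth e i)) *: tnth e i.
have f0_lin : linear f0.
  move=> a u v; rewrite scaler_sumr -big_split; apply: eq_bigr => i _ /=.
  by rewrite linearPl /= mulrDr scalerDl scalerA mulrCA.
pose fl : {linear V -> V} := HB.pack f0 (GRing.isLinear.Build _ _ _ _ f0 f0_lin).
exists (linfun fl); split=> [i|v w].
  rewrite lfunE /= /f0 (bigD1 i) //= big1 ?addr0 => [|j ji].
    by rewrite dot_basis eqxx mulr1.
  by rewrite dot_basis eq_sym (negbTE ji) mulr0 scale0r.
rewrite !lfunE /= /f0 dot_suml [RHS]dot_sym dot_suml; apply: eq_bigr => i _.
by rewrite !linearZl_LR /= [g _ w]dot_sym [g _ v]dot_sym mulrAC.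
Qed.

End OrthonormalBasis.

Lemma exists_block (n m : nat) (I : 'I_m -> seq 'I_n) :
    (0 < m)%N ->
    (forall a a', a != a' -> [set i in I a] :&: [set i in I a'] = set0) ->
    ~: (\bigcup_a [set i in I a]) = set0 ->
  exists b : 'I_n -> 'I_m, forall i a, (i \in I a) = (b i == a).
Proof.
move=> m_gt0 disj cover.
(* The default never occurs, as the blocks cover all indices. *)
exists (fun i => odflt (Ordinal m_gt0) [pick a | i \in I a]) => i a.
have [a' ia'] : exists a', i \in I a'.
  have: i \in \bigcup_a [set i in I a].
    by move/setP/(_ i): cover; rewrite !inE => /negbFE.
  by case/bigcupP => a' _; rewrite inE; exists a'.
case: pickP => [c ic /=|/(_ a')]; last by rewrite ia'.
apply/idP/eqP => [ia|<- //]; apply/eqP/negPn/negP => /disj/setP/(_ i).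
by rewrite !inE ic ia.
Qed.

(** * Gamma matrices and the complexified action of q *)

Section Realization.
Variables (R : realType) (V : vectType R) (g : {dot V for idfun}).

(** Treats the Clifford algebra and its irreducible images at once, [rho] carrying the relation
    over. *)
Lemma gamma_realization_linear (B : algType R[i]) (iota : V -> B) :
    gamma_realization g iota ->
  [/\ forall u v, iota (u + v) = iota u + iota v,
      forall a v, iota (a *: v) = a%:C *: iota v
    & clifford_relation g iota].
Proof.
case=> [A f [rel _]|A f N rho [rel _] _]; split=> //.
- by move=> u v; rewrite linearD.
- by move=> a v; rewrite linearZ.
- by move=> u v; rewrite linearD /= rmorphD.
- by move=> a v; rewrite linearZ_LR /= linearZ_LR.
move=> u v /=; rewrite -!rmorphM -rmorphD rel.
exact: rmorph_alg.
Qed.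

Variables (n : nat) (e : n.-tuple V).
Hypothesis e_basis : basis_of fullv e.
Hypothesis e_orthonormal : orthonormal g e.
Variables (B : algType R[i]) (iota : V -> B).
Hypothesis iotaP : gamma_realization g iota.

Let G i := iota (tnth e i).

Lemma gamma_sqr i : G i * G i = -1.
Proof.
case: (gamma_realization_linear iotaP) => _ _ rel.
have := rel (tnth e i) (tnth e i); rewrite (dot_basis e_orthonormal) eqxx mulr1.
rewrite -/(G i) -mulr2n rmorphN rmorph_nat scaleNr scaler_nat => /eqP.
rewrite -mulNrn -subr_eq0 -mulrnBl -scaler_nat scaler_eq0 pnatr_eq0 /=.
by rewrite subr_eq0 => /eqP.
Qed.

Lemma gamma_anti i j : i != j -> G i * G j = - (G j * G i).
Proof.
case: (gamma_realization_linear iotaP) => _ _ rel ij.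
have := rel (tnth e i) (tnth e j).
rewrite (dot_basis e_orthonormal) (negbTE ij) mulr0 scale0r => /eqP.
by rewrite addr_eq0 => /eqP.
Qed.

Lemma iota_sum (x : 'I_n -> R) :
  iota (\sum_i x i *: tnth e i) = vec G (fun i => (x i)%:C).
Proof.
case: (gamma_realization_linear iotaP) => iD iZ _.
have i0 : iota 0 = 0 by rewrite -(scale0r 0) iZ scale0r.
rewrite (big_morph iota iD i0); apply: eq_bigr => i _.
by rewrite iZ.
Qed.

Lemma iota_expansion v : iota v = vec G (fun i => (g v (tnth e i))%:C).
Proof. by rewrite -iota_sum -basis_expansion. Qed.

Lemma qE_q_map m (E : 'I_m -> B) (eb : 'I_m -> bool) x :
  qE eb E x = q_map (\sum_a E a) (\sum_a sg (eb a) *: E a) x.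
Proof.
rewrite /qE /q_map; move: (\sum_a E a) (\sum_a _) => c d.
rewrite mulr_natl mulr2n !expr2 mulrBr mulrBl opprB !mulrA opprD.
by rewrite addrACA.
Qed.

Lemma q_map_lin c d (x y : B) (k l : R[i]) :
  q_map c d (k *: x + l *: y) = k *: q_map c d x + l *: q_map c d y.
Proof.
rewrite /q_map !mulr_natl !scalerBr !scalerDr !(mulrDr, mulrDl) -!(scalerAr, scalerAl).
rewrite mulrnDl !scalerMnr opprD.
by rewrite -!mulr2n !scalerMnr (AC ((2*2)*2) (((1*3)*5)*((2*4)*6))).
Qed.

Lemma q_map_vec c d (x : 'I_n -> R[i]) :
  q_map c d (vec G x) = \sum_i x i *: q_map c d (G i).
Proof.
have q0 : q_map c d (0 : B) = 0.
  by have := q_map_lin c d 0 0 0 0; rewrite !scale0r !addr0.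
have qD (y z : B) : q_map c d (y + z) = q_map c d y + q_map c d z.
  by have := q_map_lin c d y z 1 1; rewrite !scale1r.
rewrite (big_morph _ qD q0); apply: eq_bigr => i _.
by have := q_map_lin c d (G i) 0 (x i) 0; rewrite !scale0r !addr0.
Qed.

(** A real injective map stays injective on complex vectors: split x into u + i w, and the
    independence of the generators gives f u = f w = 0. *)
Lemma q_map_inj c d (f : 'End(V)) (x : 'I_n -> R[i]) :
    q_restricts_to iota c d f -> lker f = 0%VS ->
  q_map c d (vec G x) = 0 -> forall i, x i = 0.
Proof.
move=> fP ker0.
pose u := \sum_i complex.Re (x i) *: tnth e i.
pose w := \sum_i complex.Im (x i) *: tnth e i.
have comb : vec G x = 1 *: iota u + 'i *: iota w.
  rewrite !iota_sum /vec !scaler_sumr -big_split; apply: eq_bigr => i _ /=.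
  by rewrite !scalerA mul1r -scalerDl -complexE.
have dot_eq0 v : (forall i, g v (tnth e i) = 0) -> v = 0.
  move=> v0; rewrite (basis_expansion e_basis e_orthonormal v) big1 // => i _.
  by rewrite v0 scale0r.
rewrite comb q_map_lin !fP !iota_expansion => q0.
have {}q0 i : g (f u) (tnth e i) = 0 /\ g (f w) (tnth e i) = 0.
  have: vec G (fun i => (g (f u) (tnth e i))%:C + 'i * (g (f w) (tnth e i))%:C) =
        vec G (fun=> 0).
    rewrite [RHS]big1 => [|j _]; last by rewrite scale0r.
    rewrite -[RHS]q0 /vec !scaler_sumr -big_split; apply: eq_bigr => j _ /=.
    by rewrite !scalerA mul1r -scalerDl.
  move/(vec_inj gamma_sqr gamma_anti)/(_ i) => /=; simpc.
  by move=> [-> ->].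
have ker v : f v = 0 -> v = 0.
  by move=> fv; apply/eqP; rewrite -memv0 -ker0 memv_ker fv.
have u0 : u = 0 by apply/ker/dot_eq0 => i; case: (q0 i).
have w0 : w = 0 by apply/ker/dot_eq0 => i; case: (q0 i).
move=> i; rewrite [x i]complexE.
rewrite -(dot_sum_basis e_orthonormal (fun i => complex.Re (x i))) -/u u0.
rewrite -(dot_sum_basis e_orthonormal (fun i => complex.Im (x i))) -/w w0.
by rewrite linear0l rmorph0 mulr0 addr0.
Qed.

(** The scalars [mu i] are a priori complex; they are real because they are coordinates of
    [f (tnth e i)]. *)
Lemma restriction_diag c d (f : 'End(V)) (mu : 'I_n -> R[i]) :
    q_restricts_to iota c d f -> (forall i, q_map c d (G i) = mu i *: G i) ->
  exists lam : 'I_n -> R,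
    (forall i, (lam i)%:C = mu i) /\ (forall i, f (tnth e i) = lam i *: tnth e i).
Proof.
move=> fP qG.
have fG i j : (g (f (tnth e i)) (tnth e j))%:C = (j == i)%:R * mu i.
  move: j; apply: (vec_inj gamma_sqr gamma_anti).
  rewrite -iota_expansion -fP -/(G i) qG /vec (bigD1 i) //= big1 => [|j ji].
    by rewrite eqxx mul1r addr0.
  by rewrite (negbTE ji) mul0r scale0r.
exists (fun i => g (f (tnth e i)) (tnth e i)); split=> i.
  by rewrite fG eqxx mul1r.
rewrite [LHS](basis_expansion e_basis e_orthonormal) (bigD1 i) //= big1 ?addr0 //.
move=> j ji; have := fG i j; rewrite (negbTE ji) mul0r => -[->].
by rewrite scale0r.
Qed.

End Realization.

Lemma sum_block_sizes (n m : nat) (I : 'I_m -> seq 'I_n) (b : 'I_n -> 'I_m) :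
    (forall a, uniq (I a)) -> (forall i a, (i \in I a) = (b i == a)) ->
  (\sum_a size (I a))%N = n.
Proof.
move=> I_uniq bP; rewrite -[RHS]card_ord -sum1_card.
rewrite (partition_big b predT) //=; apply: eq_bigr => a _.
rewrite sum1_card -(card_uniqP (I_uniq a)); apply: eq_card => i.
by rewrite bP.
Qed.

(** * Characterization of the pairs and their eigenvalues *)

Theorem proposition2p21 (R : realType) (V : vectType R) (g : {dot V for idfun})
    (n : nat) (e : n.-tuple V)
    (e_basis : basis_of fullv e) (e_orthonormal : orthonormal g e)
    (B : algType R[i]) (iota : V -> B) (iotaP : gamma_realization g iota)
    (m : nat) (m_gt2 : (2 < m)%N)
    (I : 'I_m -> seq 'I_n) (c d eps sigma : 'I_m -> R[i])
    (I_distinct : forall alpha, uniq (I alpha))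
    (I_nonempty : forall alpha, (0 < size (I alpha))%N)
    (I_disjoint : forall alpha beta, alpha != beta ->
       [set i in I alpha] :&: [set i in I beta] = set0)
    (I_cover : ~: (\bigcup_alpha [set i in I alpha]) = set0)
    (c_neq0 : forall alpha, c alpha != 0)
    (eps_sign : forall alpha, eps alpha = 1 \/ eps alpha = -1)
    (d_def : forall alpha, d alpha = eps alpha * c alpha)
    (sigma_sign : forall alpha, sigma alpha = 1 \/ sigma alpha = -1)
    (sigma_def : forall alpha, Gamma iota e (I alpha) ^+ 2 = (sigma alpha)%:A) :
  let pair_cd :=
    nondegenerate_quadratic_clifford_pair g iota
      (Gamma_sum iota e I c) (Gamma_sum iota e I d) in
  let parity_and_signs :=
    (~~ odd (\dim {:V}) -> forall alpha, ~~ odd (size (I alpha))) /\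
    (odd (\dim {:V}) -> exists alpha0, forall alpha,
       alpha != alpha0 -> ~~ odd (size (I alpha))) /\
    (forall alpha, eps alpha = (-1) ^+ size (I alpha)) in
  (pair_cd -> parity_and_signs) /\
  ((forall alpha, c alpha ^+ 2 \is Num.real) -> parity_and_signs -> pair_cd) /\
  (pair_cd ->
     forall f : 'End(V),
       q_restricts_to iota (Gamma_sum iota e I c) (Gamma_sum iota e I d) f ->
       exists lambda : 'I_m -> R,
         (forall alpha, (lambda alpha)%:C = 4 * sigma alpha * c alpha ^+ 2) /\
         forall x : R,
           \dim (passmx.leigenspace f x) =
             (\sum_(alpha < m | lambda alpha == x) size (I alpha))%N).
Proof.
have m_gt0 : (0 < m)%N by apply: leq_trans m_gt2.
have [b bP] := exists_block m_gt0 I_disjoint I_cover.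
pose G i := iota (tnth e i).
have GG := gamma_sqr e_orthonormal iotaP.
have GA := gamma_anti e_orthonormal iotaP.
pose p a := odd (size (I a)); pose eb a := eps a == -1.
(* With c_a absorbed into the block, the summands of d are eps_a E_a. *)
pose E a := c a *: Gamma iota e (I a); pose w a := sigma a * c a ^+ 2.
have epsE a : eps a = sg (eb a).
  rewrite /eb; case: (eps_sign a) => ->; last by rewrite eqxx.
  by rewrite -subr_eq0 opprK -mulr2n pnatr_eq0.
have b_surj a : exists i, b i = a.
  case Ia: (I a) (I_nonempty a) => [//|i s] _; exists i.
  by apply/eqP; rewrite -bP Ia mem_head.
have fiberE a : fiber_size b a = size (I a).
  rewrite -(card_uniqP (I_distinct a)); apply: eq_card => i.
  by rewrite bP.
have p_odd a : p a = odd (fiber_size b a) by rewrite fiberE.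
have G_E j a : G j * E a = sg (p a (+) (b j == a)) *: (E a * G j).
  rewrite -scalerAr (G_prod_comm GA) // -scalerAl !scalerA mulrC.
  by rewrite bP.
have E_comm a a' : a != a' -> E a * E a' = sg (p a && p a') *: (E a' * E a).
  move=> aa'; rewrite -!scalerAr -!scalerAl (G_prod_prod_comm GA) //.
    by rewrite !scalerA; congr (_ *: _); ring.
  by apply/hasPn => i; rewrite bP => /eqP bi; rewrite -[mem _ i]/(i \in I a') bP bi.
have w_neq0 a : w a != 0.
  rewrite mulf_neq0 ?expf_neq0 //.
  by case: (sigma_sign a) => ->; rewrite ?oppr_eq0 oner_eq0.
have E_sqr a : E a * E a = (w a)%:A.
  rewrite -scalerAl -scalerAr -expr2 sigma_def !scalerA.
  by congr (_ *: _); rewrite /w; ring.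
have E_single i : fiber_size b (b i) = 1%N -> E (b i) = c (b i) *: G i.
  rewrite fiberE /E /Gamma; have := bP i (b i); rewrite eqxx.
  case: (I (b i)) => [//|j [|//]]; rewrite inE big_seq1 => /eqP <- _.
  by [].
have dE : Gamma_sum iota e I d = \sum_a sg (eb a) *: E a.
  by apply: eq_bigr => a _; rewrite d_def epsE scalerA.
have qP x : qE eb E x = q_map (Gamma_sum iota e I c) (Gamma_sum iota e I d) x.
  by rewrite dE qE_q_map.
pose few := forall a a', a != a' -> ~~ (p a && p a').
have sum_p : n = (\sum_a size (I a))%N by rewrite (sum_block_sizes I_distinct bP).
move=> pair_cd parity_and_signs.
have necessary : pair_cd -> (forall a, signs_differ p eb a = false) /\ few.
  case=> -[f [fP f_sym]] /(_ f fP) ker0.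
  pose M i j := (g (f (tnth e i)) (tnth e j))%:C.
  apply: (pair_necessary GG GA m_gt2 b_surj G_E E_comm w_neq0 E_sqr p_odd
            (M := M) _ c_neq0 E_single).
  - by move=> i; rewrite qP fP (iota_expansion e_basis e_orthonormal iotaP).
  - by move=> i j; rewrite /M f_sym dot_sym.
  move=> x; rewrite qP.
  exact: (q_map_inj e_basis e_orthonormal iotaP fP ker0).
have parityE : parity_and_signs <-> (forall a, signs_differ p eb a = false) /\ few.
  have ebE a : (signs_differ p eb a = false) <-> eps a = (-1) ^+ size (I a).
    rewrite epsE -(signr_odd _ (size (I a))) -/(p a) /signs_differ.
    have n1 : (-1 == 1 :> R[i]) = false.
      by rewrite eq_sym -subr_eq0 opprK -mulr2n pnatr_eq0.
    case: (p a); case: (eb a); split=> //=; rewrite ?expr1 ?expr0 // => /eqP;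
      by rewrite ?n1 // eq_sym n1.
  rewrite /parity_and_signs (dim_basis e_basis).
  split=> [[p_even [p_odd1 epsP]]|[v0 few0]].
    split=> [a|a a' aa']; first by apply/ebE.
    have [n_odd|n_even] := boolP (odd n); last by rewrite /p (negbTE (p_even _ _)).
    have [a0 a0P] := p_odd1 n_odd; rewrite negb_and /p.
    by have [aa0|/a0P->//] := eqVneq a a0; rewrite (a0P a') ?orbT // -aa0 eq_sym.
  split; last split; last by move=> a; apply/ebE.
    (* The dimension is the sum of the block sizes, so a single odd block makes it odd. *)
    move=> n_even a; apply: contra n_even => pa.
    rewrite sum_p (bigD1 a) //= oddD pa /= -dvdn2 dvdn_sum // => a' a'a.
    by have := few0 _ _ a'a; rewrite /p pa andbT dvdn2.
  move=> _; case: (pickP p) => [a0 pa0|p0].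
    by exists a0 => a aa0; have := few0 _ _ aa0; rewrite pa0 andbT.
  (* Without odd blocks any index can be named as the exception. *)
  by exists (Ordinal m_gt0) => a _; have := p0 a; rewrite /p => ->.
have diag : (forall a, signs_differ p eb a = false) -> few -> forall i,
    q_map (Gamma_sum iota e I c) (Gamma_sum iota e I d) (G i) =
    (4 * w (b i)) *: G i.
  by move=> v0 few0 i; rewrite -qP (qE_diag G_E E_comm E_sqr).
split; first by move/necessary/parityE.
split.
  move=> c_real /parityE[v0 few0].
  pose lam i := complex.Re (4 * w (b i)).
  have lamE i : (lam i)%:C = 4 * w (b i).
    rewrite /lam RRe_real // rpredM ?realn // rpredM ?c_real //.
    by case: (sigma_sign (b i)) => ->; rewrite ?rpredN rpred1.
  have [f [fe f_sym]] := exists_diag e_orthonormal lam.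
  split.
    exists f; split=> // v.
    rewrite (iota_expansion e_basis e_orthonormal iotaP v) q_map_vec.
    rewrite (diag_apply e_basis e_orthonormal v fe) (iota_sum e iotaP).
    apply: eq_bigr => i _; rewrite diag // scalerA -lamE -rmorphM.
    by rewrite mulrC.
  (* Any restriction is diagonal with the non-zero eigenvalues 4 [w (b i)], so its kernel is
     trivial. *)
  move=> f' f'P.
  have [mu [muE fe']] := restriction_diag e_basis e_orthonormal iotaP f'P (diag v0 few0).
  apply/eqP; rewrite -subv0; apply/subvP => v; rewrite memv_ker memv0 => /eqP fv.
  rewrite (basis_expansion e_basis e_orthonormal v) big1 // => i _.
  have := dot_sum_basis e_orthonormal (fun i => mu i * g v (tnth e i)) i.
  rewrite /= -(diag_apply e_basis e_orthonormal v fe') fv linear0l => /esym/eqP.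
  rewrite mulf_eq0 => /orP[/eqP mu0|/eqP ->]; last by rewrite scale0r.
  have := w_neq0 (b i); have := muE i; rewrite mu0 => /esym/eqP.
  by rewrite rmorph0 mulf_eq0 pnatr_eq0 /= => ->.
move=> /necessary[v0 few0] f fP.
have [mu [muE fe]] := restriction_diag e_basis e_orthonormal iotaP fP (diag v0 few0).
exists (fun a => complex.Re (4 * w a)); split=> [a|x].
  have [i <-] := b_surj a; rewrite -muE /= muE.
  by rewrite /w mulrA.
rewrite (dim_eigenspace_diag e_basis e_orthonormal x fe).
(* Blocks may share an eigenvalue, so the count is grouped by block and summed over all blocks with
   value x. *)
rewrite -sum1_card (partition_big b (fun a => complex.Re (4 * w a) == x)) /=.
  apply: eq_bigr => a ax; rewrite -fiberE /fiber_size -sum1_card.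
  apply: eq_bigl => i; rewrite !inE.
  case: (eqVneq (b i) a) => [bi|_]; last by rewrite andbF.
  by rewrite andbT -(eqP ax) -bi -muE /= eqxx.
by move=> i; rewrite inE => /eqP <-; rewrite -muE.
Qed.
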